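(* Let $a\neq0$ be a real number. An admissible parabolic rotational surface has a constant ratio $a$ of isotropic principal curvatures if and only if it is isotropic similar to a subset of the paraboloid $z=x^2+ay^2$.
   Context: We work in $\mathbb{R}^3$ with coordinates $x,y,z$. A surface is an embedded connected 2-dimensional $C^3$ submanifold of $\mathbb{R}^3$, possibly with boundary and possibly non-compact. A surface is admissible if none of its tangent planes is parallel to the $z$-axis; it is then locally a graph $z=f(x,y)$. The isotropic principal curvatures $\kappa_1,\kappa_2$ at a point are the eigenvalues of the Hessian $\nabla^2 f$; $H=\frac{\kappa_1+\kappa_2}{2}$ and $K=\kappa_1\kappa_2$ are the isotropic mean and Gaussian curvatures. An admissible surface has a constant ratio $a$ of isotropic principal curvatures if $K\neq0$ and ($\kappa_1/\kappa_2=a$ or $\kappa_2/\kappa_1=a$) at each of its points; equivalently, $K\ne 0$ and $H^2/K=(a+1)^2/(4a)$. A general isotropic similarity is an invertible affine map $\mathbf{x}\mapsto A\mathbf{x}+\mathbf{b}$ of $\mathbb{R}^3$ with $A=\begin{pmatrix}\pm h_1&\mp h_2&0\\ h_2&h_1&0\\ c_1&c_2&c_3\end{pmatrix}$, $\mathbf b\in\mathbb{R}^3$, $h_1,h_2,c_1,c_2,c_3\in\mathbb{R}$; it is an isotropic congruence if $h_1=\cos\phi$, $h_2=\sin\phi$, $c_3=1$. Two sets are isotropic similar if some general isotropic similarity takes one to the other. A parabolic rotation is a map $(x,y,z)\mapsto(x+t,\;y,\;t^2/2+(x+by)t+z)$ with parameters $b,t\in\mathbb{R}$. A surface invariant under all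 parabolic rotations with $b$ fixed and $t$ running through $\mathbb{R}$, and the image of such a surface under any isotropic congruence, is called parabolic rotational. *)

(* Defs.v *)
(* Points of R^3 are column vectors over an arbitrary [R : realType]. *)
From HB Require Import structures.
From mathcomp Require Import all_boot all_order all_algebra.
From mathcomp Require Import all_classical all_reals all_analysis.
Set Implicit Arguments.
Unset Strict Implicit.
Unset Printing Implicit Defensive.
Import Order.TTheory GRing.Theory Num.Theory.
Import numFieldNormedType.Exports.
Local Open Scope classical_set_scope.
Local Open Scope ring_scope.

Section Points.
Context {R : realType}.

Definition xc (p : 'cV[R]_3) : R := p 0 0.
Definition yc (p : 'cV[R]_3) : R := p 1 0.
Definition zc (p : 'cV[R]_3) : R := p 2 0.

Definition vec3 (x y z : R) : 'cV[R]_3 := \col_i [:: x; y; z]`_i.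

(* The projection along the z-axis onto the (x, y)-plane. *)
Definition xy (p : 'cV[R]_3) : 'cV[R]_2 := \col_i [:: xc p; yc p]`_i.

End Points.

Section Smoothness.
Context {R : realType}.

(* f is of class C^k on U.  Meant for open U: both [differentiable] and the
   directional derivative ['D_v f] refer to full neighbourhoods in R^n. *)
Fixpoint class_C (n : nat) (W : normedModType R) (k : nat)
    (U : set 'cV[R]_n) (f : 'cV[R]_n -> W) : Prop :=
  if k is k'.+1 then
    (forall x, U x -> differentiable f x) /\
    (forall v, class_C k' U ('D_v f))
  else forall x, U x -> {for x, continuous f}.

Definition diffeo_C3 (U V : set 'cV[R]_3) (Phi : 'cV[R]_3 -> 'cV[R]_3) : Prop :=
  [/\ open U, open V, class_C 3 U Phi, Phi @` U = V &
      exists2 Psi : 'cV[R]_3 -> 'cV[R]_3,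
        class_C 3 V Psi & forall x, U x -> Psi (Phi x) = x].

(* A chart of R^3 around p that flattens S onto the plane z = 0, or onto its
   closed half-plane z = 0, x >= 0 (the case needed at boundary points). *)
Definition flattening (S : set 'cV[R]_3) (p : 'cV[R]_3)
    (U : set 'cV[R]_3) (Phi : 'cV[R]_3 -> 'cV[R]_3) : Prop :=
  U p /\
  exists V : set 'cV[R]_3, diffeo_C3 U V Phi /\
    (Phi @` (S `&` U) = V `&` [set w | zc w = 0] \/
     Phi @` (S `&` U) = V `&` [set w | zc w = 0 /\ 0 <= xc w]).

Definition surface (S : set 'cV[R]_3) : Prop :=
  connected S /\ forall p, S p -> exists U Phi, flattening S p U Phi.

(* The linear tangent plane; it does not depend on the chart, and it is a full
   plane at boundary points as well. *)
Definition tangent_plane (S : set 'cV[R]_3) (p : 'cV[R]_3) : set 'cV[R]_3 :=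
  [set v | exists U Phi, flattening S p U Phi /\ zc ('d Phi p v) = 0].

Definition admissible (S : set 'cV[R]_3) : Prop :=
  forall p, S p -> ~ tangent_plane S p (vec3 0 0 1).

End Smoothness.

Section Curvature.
Context {R : realType}.

(* Near p, the set S lies on the graph z = f(x, y) of a C^3 function f defined
   around (x, y)(p).  At an interior point of an admissible surface S is then
   equal to that graph near p; at a boundary point f extends S across its
   boundary, and the Hessian at p does not depend on the extension. *)
Definition local_graph (S : set 'cV[R]_3) (p : 'cV[R]_3)
    (f : 'cV[R]_2 -> R) : Prop :=
  (exists U : set 'cV[R]_2, [/\ open U, U (xy p) & class_C 3 U f]) /\
  (\forall q \near p, S q -> zc q = f (xy q)).

Definition hessian (f : 'cV[R]_2 -> R) (q : 'cV[R]_2) : 'M[R]_2 :=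
  \matrix_(i, j) 'D_(delta_mx j 0) ('D_(delta_mx i 0) f) q.

(* k1, k2 are the eigenvalues, listed with multiplicity (so that k1 = k2 only
   at umbilic points). *)
Definition isotropic_principal_curvatures (S : set 'cV[R]_3) (p : 'cV[R]_3)
    (k1 k2 : R) : Prop :=
  exists f, local_graph S p f /\
    char_poly (hessian f (xy p)) = ('X - k1%:P) * ('X - k2%:P).

Definition constant_ratio (a : R) (S : set 'cV[R]_3) : Prop :=
  forall p, S p -> exists k1 k2,
    [/\ isotropic_principal_curvatures S p k1 k2, k1 * k2 != 0 &
        k1 / k2 = a \/ k2 / k1 = a].

End Curvature.

Section Transformations.
Context {R : realType}.

(* The boolean e selects the upper (false) or lower (true) signs. *)
Definition isotropic_mx (e : bool) (h1 h2 c1 c2 c3 : R) : 'M[R]_3 :=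
  \matrix_(i, j) (nth [::]
    [:: [:: (-1) ^+ e * h1; - (-1) ^+ e * h2;  0];
        [::             h2;               h1;  0];
        [::             c1;               c2; c3]] i)`_j.

Definition isotropic_similarity (g : 'cV[R]_3 -> 'cV[R]_3) : Prop :=
  exists e h1 h2 c1 c2 c3 (b : 'cV[R]_3),
    isotropic_mx e h1 h2 c1 c2 c3 \in unitmx /\
    forall x, g x = isotropic_mx e h1 h2 c1 c2 c3 *m x + b.

Definition isotropic_congruence (g : 'cV[R]_3 -> 'cV[R]_3) : Prop :=
  exists e phi c1 c2 (b : 'cV[R]_3),
    forall x, g x = isotropic_mx e (cos phi) (sin phi) c1 c2 1 *m x + b.

Definition isotropic_similar (S T : set 'cV[R]_3) : Prop :=
  exists2 g, isotropic_similarity g & g @` S = T.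

Definition parabolic_rotation (b t : R) (p : 'cV[R]_3) : 'cV[R]_3 :=
  vec3 (xc p + t) (yc p) (t ^+ 2 / 2 + (xc p + b * yc p) * t + zc p).

Definition parabolic_rotational (S : set 'cV[R]_3) : Prop :=
  exists (S0 : set 'cV[R]_3) (b : R) (g : 'cV[R]_3 -> 'cV[R]_3),
    [/\ surface S0, forall t, parabolic_rotation b t @` S0 = S0,
        isotropic_congruence g & S = g @` S0].

Definition paraboloid (a : R) : set 'cV[R]_3 :=
  [set p | zc p = xc p ^+ 2 + a * yc p ^+ 2].

End Transformations.

(* Main.v *)
Require Import Defs.
From HB Require Import structures.
From mathcomp Require Import all_boot all_order all_algebra.
From mathcomp Require Import all_classical all_reals all_analysis.
From mathcomp Require Import ring lra.
Set Implicit Arguments.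
Unset Strict Implicit.
Unset Printing Implicit Defensive.
Import Order.TTheory GRing.Theory Num.Theory.
Import numFieldNormedType.Exports.
Local Open Scope classical_set_scope.
Local Open Scope ring_scope.

(** Up to a congruence, the surface is swept out by its profile
    C = {(y, z) : (0, y, z) in S0}: it consists of the points
    (x, y, x^2/2 + b x y + z) with (y, z) in C ([profileP]).  Where C runs along
    the graph of a C^2 function u, the surface is the graph of
    x^2/2 + b x y + u(y), whose Hessian has the entries 1, b, b, u''
    ([profile_curvature]).  The eigenvalues k1, k2 of a 2x2 matrix have ratio a
    or 1/a exactly when a (k1 + k2)^2 = (1 + a)^2 k1 k2, because the difference
    of the two sides is (a k1 - k2) (k1 - a k2).  So w = u'' satisfies
    a (1 + w)^2 = (1 + a)^2 (w - b^2), a genuine quadratic equation since a is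
    nonzero.  A continuous function with values among the at most two roots is
    constant along an arc; hence C is locally a parabola, and by continuation
    along the connected set C it lies on a single one
    ([connected_curve_on_parabola]).

    Therefore the surface lies on the graph of a quadratic polynomial whose
    Hessian has eigenvalues of ratio a.  Turning its axes to the eigenvectors,
    scaling z and removing the linear terms by a shear maps this graph to
    z = x^2 + a y^2 ([quadric_isotropic_paraboloid]).

    Conversely, the preimage of z = x^2 + a y^2 under an isotropic similarity is
    the graph of a quadratic polynomial whose constant Hessian has eigenvalues
    k and a k ([paraboloid_pullback_quadric], [paraboloid_constant_ratio]).

    The profile is handled as a connected subset of the plane which near each of
    its points lies on a graph.  It need not fill that graph on both sides of
    the point, but on each side it contains either a whole arc or nothing
    ([arc_dichotomy]), and this is enough to differentiate up to the point.  If
    both sides are empty, C is a single point and the surface degenerates to one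
    parabola, which lies on a quadric with Hessian diag(1, a). *)

(** * Functions of one real variable *)

Definition quadratic (R : realType) (w m n y : R) := w / 2 * y ^+ 2 + m * y + n.

Lemma quadratic_is_derive (R : realType) (w m n s : R) :
  is_derive s (1 : R) (quadratic w m n) (w * s + m).
Proof.
have -> : quadratic w m n = (w / 2) *: (id * id) + m *: id + cst n.
  by apply/funext => x; rewrite /quadratic expr2.
have i := is_derive_id s (1 : R).
apply: (is_derive_eq (is_deriveD (is_deriveD (is_deriveZ (w / 2) (is_deriveM i i))
  (is_deriveZ m i)) (is_derive_cst n s 1))).
by rewrite /GRing.scale/=; field.
Qed.

Lemma quadratic_of_const_derive2 (R : realType) (v v1 : R -> R) (w b : R) :
  0 <= b ->
  (forall t, 0 <= t <= b -> is_derive t 1 v (v1 t) /\ is_derive t 1 v1 w) ->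
  v b = v 0 + v1 0 * b + w / 2 * b ^+ 2.
Proof.
move=> b0 dv.
have cts (f : R -> R) c : c <= b ->
    (forall t, 0 <= t <= b -> derivable f t 1) -> {within `[0, c], continuous f}.
  move=> cb df; apply: continuous_in_subspaceT => x; rewrite inE/= in_itv/=.
  move=> /andP[x0 xc]; apply/differentiable_continuous/derivable1_diffP/df.
  by rewrite x0 (le_trans xc).
have v1E t : 0 <= t <= b -> v1 t = v1 0 + w * t.
  move=> /andP[t0 tb].
  have [|| c _] := @MVT_segment _ v1 (fun=> w) _ _ t0.
  - move=> x; rewrite in_itv/= => /andP[x0 xt].
    by apply: (dv x _).2; rewrite ltW//= ltW// (lt_le_trans xt).
  - by apply: cts => // x /dv[_ []].
  by rewrite subr0 => /eqP; rewrite subr_eq addrC => /eqP.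
(* The defect of the Taylor formula has zero derivative. *)
pose h := v - quadratic w (v1 0) 0.
have dh t : 0 <= t <= b -> is_derive t 1 h 0.
  move=> tb; have [dvt _] := dv _ tb.
  apply: (is_derive_eq (is_deriveB dvt (quadratic_is_derive w (v1 0) 0 t))).
  by rewrite v1E//; ring.
have [|| c _] := @MVT_segment _ h (fun=> 0) _ _ b0.
- move=> x; rewrite in_itv/= => /andP[x0 xb].
  by apply: dh; rewrite !ltW.
- by apply: cts => // x /dh[].
rewrite mul0r -[h b]/(v b - quadratic w (v1 0) 0 b).
by rewrite -[h 0]/(v 0 - quadratic w (v1 0) 0 0) /quadratic; lra.
Qed.

(** A set containing no midpoint of two of its distinct elements stands for the
    root set of a quadratic equation.  By the intermediate value theorem a
    continuous function that took two such values would also take their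
    midpoint. *)
Lemma continuous_midpoint_free_cst (R : realType) (Z : set R) (v : R -> R)
    (e : R) :
  (forall x y, Z x -> Z y -> x != y -> ~ Z ((x + y) / 2)) ->
  (forall t : R, 0 <= t < e -> {for t, continuous v}) ->
  (forall t : R, 0 < t < e -> Z (v t)) ->
  forall t : R, 0 <= t < e -> v t = v 0.
Proof.
move=> Zmid cv Zv.
have mid (s t : R) : 0 <= s -> s <= t -> t < e ->
    exists2 c, s <= c <= t & v c = (v s + v t) / 2.
  move=> s0 st te; have [|| c] := @IVT _ v s t ((v s + v t) / 2) st.
  - apply: continuous_in_subspaceT => x; rewrite inE/= in_itv/= => /andP[sx xt].
    by apply: cv; rewrite (le_trans s0)//= (le_lt_trans xt).
  - by case: (leP (v s) (v t)) => h; apply/andP; split; lra.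
  - by rewrite in_itv/= => ? ?; exists c.
have pos (s t : R) : 0 < s -> s <= t -> t < e -> v s = v t.
  move=> s0 st te; apply/eqP/negPn/negP => vst.
  have [c /andP[sc ct] vc] := mid _ _ (ltW s0) st te.
  apply: (Zmid _ _ _ _ vst); [apply: Zv..|rewrite -vc; apply: Zv]; lra.
move=> t /andP[]; rewrite le_eqVlt => /predU1P[<-//|t0 te].
have [c /andP[c0 ct] vc] := mid _ _ (lexx 0) (ltW t0) te.
have [c00|cn0] := eqVneq c 0; first by move: vc; rewrite c00; lra.
have cp : 0 < c by rewrite lt_def cn0.
by have := pos _ _ cp ct te; lra.
Qed.

Lemma sqr1_norm (R : realType) (s : R) : s ^+ 2 = 1 -> `|s| = 1.
Proof.
by move=> s2; apply/eqP; rewrite -(@eqrXn2 _ 2)// expr1n real_normK ?num_real// s2.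
Qed.

(** * Connected plane sets lying locally on graphs *)

(** Here s = 1 or s = -1 selects the side of p.  If C misses the graph over two
    abscissas at distances t1 < t2 from p, then the part of C strictly between
    them in a small box around p is both open and closed in C, and does not
    contain p; so it is empty.  Hence, if C misses points of the graph
    arbitrarily close to p, it misses a whole arc. *)
Lemma arc_dichotomy (R : realType) (C : set (R * R)) (p : R * R) (u : R -> R)
    (s : R) :
  s ^+ 2 = 1 -> connected C -> C p -> {for p.1, continuous u} ->
  (\forall q \near p, C q -> q.2 = u q.1) ->
  exists2 e : R, 0 < e &
    (forall t, 0 < t < e -> C (p.1 + s * t, u (p.1 + s * t))) \/
    (forall t, 0 < t < e -> ~ C (p.1 + s * t, u (p.1 + s * t))).
Proof.
move=> s2 cC Cp cu Cu.
have ns := sqr1_norm s2.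
have up : u p.1 = p.2 by rewrite (nbhs_singleton Cu).
have /nbhs_ballP[r /= r0 Cr] := Cu.
have /cvgrPdist_lt/(_ (r / 2)) := cu.
rewrite divr_gt0// => /(_ isT) /nbhs_ballP[r' /= r'0 ur].
have [[e e0 good]|nogood] := pselect (exists2 e : R, 0 < e &
    forall t, 0 < t < e -> C (p.1 + s * t, u (p.1 + s * t))).
  by exists e => //; left.
have bad (e : R) : 0 < e -> exists2 t, 0 < t < e & ~ C (p.1 + s * t, u (p.1 + s * t)).
  move=> e0; apply: contrapT => nex; apply: nogood; exists e => // t te.
  by apply: contrapT => nC; apply: nex; exists t.
have m0 : 0 < Num.min r r' by rewrite lt_min r0.
have [t2 /andP[t20]] := bad _ m0; rewrite lt_min => /andP[t2r t2r'] bad2.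
exists t2 => //; right => t3 /andP[t30 t32] good3.
have [t1 /andP[t10 t13] bad1] := bad _ t30.
pose h := fun q : R * R => s * (q.1 - p.1).
pose k := fun q : R * R => `|q.2 - p.2|.
have ch : continuous h.
  move=> q; apply: cvgM; first exact: cvg_cst.
  by apply: cvgB; [exact: cvg_fst|exact: cvg_cst].
have ck : continuous k.
  by move=> q; apply: cvg_norm; apply: cvgB; [exact: cvg_snd|exact: cvg_cst].
(* C meets the open strip U and the closed strip K in the same points: C avoids
   the two vertical sides, and u stays within r / 2 of the centre. *)
pose U := h @^-1` [set x | t1 < x < t2] `&` k @^-1` [set x | x < r].
pose K := h @^-1` [set x | t1 <= x <= t2] `&` k @^-1` [set x | x <= r / 2].
have hE q : q.1 = p.1 + s * h q by rewrite /h mulrA -expr2 s2; lra.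
have CB q : C q -> t1 <= h q <= t2 -> k q < r -> q = (p.1 + s * h q, u (p.1 + s * h q)).
  move=> Cq /andP[hq1 hq2] kq; rewrite -hE -Cr//; first by case: (q).
  split => /=; rewrite /ball/= distrC//.
  by rewrite hE addrAC subrr add0r normrM ns mul1r ger0_norm; lra.
have CUK : C `&` U = C `&` K.
  apply/seteqP; split => q [Cq] [/= /andP[h1 h2] kq].
    split=> //; split => /=; first by rewrite !ltW.
    have /(congr1 snd)/= q2 := CB q Cq ltac:(by rewrite !ltW) kq.
    rewrite /k q2 distrC -up ltW// ; apply: ur.
    by rewrite /ball/= opprD addrA subrr sub0r normrN normrM ns mul1r ger0_norm; lra.
  have kq' : k q < r by lra.
  have qE := CB q Cq ltac:(by rewrite h1 h2) kq'.
  split=> //; split => //=; rewrite !lt_def h1 h2 !andbT.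
  have ht t : h q = t -> C (p.1 + s * t, u (p.1 + s * t)) by move=> <-; rewrite -qE.
  apply/andP; split; apply/eqP; first by move=> /ht.
  by move=> /esym/ht.
have nU : ~ (C `&` U) p.
  by move=> [_ [/= /andP[+ _] _]]; rewrite /h subrr mulr0; lra.
suff CU : C `&` U = C by apply: nU; rewrite CU.
apply: cC.
- exists (p.1 + s * t3, u (p.1 + s * t3)); split=> //; split => /=.
    by rewrite /h/= addrAC subrr add0r mulrA -expr2 s2 mul1r t13.
  rewrite /k/= distrC -up (lt_trans (ur _ _)) ?ltr_pdivrMr//; last lra.
  rewrite /ball/= opprD addrA subrr sub0r normrN normrM ns mul1r ger0_norm; lra.
- exists U => //; apply: openI; apply: open_comp => //.
  have -> : [set x | t1 < x < t2] = `]t1, t2[%classic.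
    by apply/seteqP; split => x /=; rewrite in_itv.
  exact: interval_open.
- exists K => //; apply: closedI; apply: closed_comp => //.
  have -> : [set x | t1 <= x <= t2] = `[t1, t2]%classic.
    by apply/seteqP; split => x /=; rewrite in_itv.
  exact: interval_closed.
Qed.

(** The derivatives are carried as functions, so that they can be given by
    formulas that hold only near the point considered. *)
Definition C2_jet (R : realType) (u u1 u2 : R -> R) (y0 : R) :=
  \forall y \near y0, [/\ is_derive y (1 : R) u (u1 y),
    is_derive y (1 : R) u1 (u2 y) & {for y, continuous u2}].

(** In this section C is the profile and Z the set of admissible values of the
    second derivative. *)
Section ParabolicCurve.
Context {R : realType} (C : set (R * R)) (Z : set R).
Hypothesis conC : connected C.
Hypothesis graphC : forall p, C p -> exists u u1 u2, C2_jet u u1 u2 p.1 /\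
  \forall q \near p, C q -> q.2 = u q.1.
Hypothesis curvC : forall y0 u u1 u2, C2_jet u u1 u2 y0 ->
  (\forall y \near y0, C (y, u y)) -> Z (u2 y0).
Hypothesis Zmid : forall x y, Z x -> Z y -> x != y -> ~ Z ((x + y) / 2).

Lemma arc_is_parabola (u u1 u2 : R -> R) (p1 s e : R) :
  s ^+ 2 = 1 -> 0 < e ->
  (forall t, 0 <= t < e -> [/\ is_derive (p1 + s * t) 1 u (u1 (p1 + s * t)),
     is_derive (p1 + s * t) 1 u1 (u2 (p1 + s * t)) &
    {for (p1 + s * t), continuous u2}]) ->
  (forall t, 0 < t < e -> C (p1 + s * t, u (p1 + s * t))) ->
  Z (u2 p1) /\ forall t, 0 <= t < e ->
    u (p1 + s * t) = u p1 + u1 p1 * (s * t) + u2 p1 / 2 * (s * t) ^+ 2.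
Proof.
move=> s2 e0 jet good.
pose l := fun t : R => p1 + s * t.
have dl (t : R) : is_derive t 1 l s.
  have -> : l = cst p1 + s *: id by apply/funext => x; rewrite /l.
  apply: (is_derive_eq (is_deriveD (is_derive_cst p1 t 1)
    (is_deriveZ s (is_derive_id t 1)))).
  by rewrite add0r /GRing.scale/= mulr1.
have cl : continuous l.
  by move=> t; apply/differentiable_continuous/derivable1_diffP.
have ls y : y = l (s * (y - p1)) by rewrite /l mulrA -expr2 s2; lra.
have nearlt (t : R) : 0 < t < e -> \forall y \near l t, 0 < s * (y - p1) < e.
  move=> /andP[t0 te].
  have cm : {for l t, continuous (fun y => s * (y - p1))}.
    apply: cvgM; first exact: cvg_cst.
    by apply: cvgB; [exact: cvg_id|exact: cvg_cst].
  have lt : s * (l t - p1) = t by rewrite /l addrAC subrr add0r mulrA -expr2 s2 mul1r.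
  near=> y; apply/andP; split; near: y.
    by apply: (cvgr_gt _ cm); rewrite lt.
  by apply: (cvgr_lt _ cm); rewrite lt.
have Zt (t : R) : 0 < t < e -> Z (u2 (l t)).
  move=> te; apply: (curvC (u1 := u1) (u := u)).
  - apply: filterS (nearlt _ te) => y /andP[y1 y2]; rewrite [y]ls; apply: jet.
    by rewrite y2 ltW.
  - apply: filterS (nearlt _ te) => y /andP[y1 y2]; rewrite [y]ls; apply: good.
    by rewrite y1.
have le0 : l 0 = p1 by rewrite /l mulr0 addr0.
have u2c (t : R) : 0 <= t < e -> u2 (l t) = u2 p1.
  move=> te; rewrite -le0; apply: (continuous_midpoint_free_cst Zmid _ Zt te).
  move=> x xe; apply: continuous_comp; first exact: cl.
  by have [_ _] := jet _ xe.
split.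
  have e2 : 0 < e / 2 < e by lra.
  by rewrite -(u2c (e / 2)); [exact: Zt|lra].
move=> t /andP[t0 te].
pose v1 := fun t => s * u1 (l t).
rewrite -/(l t) -[u (l t)]/((u \o l) t).
rewrite (@quadratic_of_const_derive2 _ _ v1 (u2 p1) _ t0).
  by rewrite /v1 /= le0 exprMn s2; ring.
move=> x /andP[x0 xt].
have xe : 0 <= x < e by rewrite x0 (le_lt_trans xt).
have [d1 d2 _] := jet _ xe; split.
  by have := @is_derive1_comp _ u l x _ _ d1 (dl x); rewrite mulrC.
have d3 := @is_derive1_comp _ u1 l x _ _ d2 (dl x).
have -> : v1 = s *: (u1 \o l) by [].
apply: (is_derive_eq (is_deriveZ s d3)).
by rewrite -/(l x) u2c// /GRing.scale/= mulrCA -expr2 s2 mulr1.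
Unshelve. all: by end_near. Qed.

(** The parabola is the second Taylor polynomial T of u at p: each side of p
    carries either no point of C or an arc on which u agrees with T, so that the
    two sides need no matching. *)
Lemma locally_parabola p : C p -> ~ (C `<=` [set p]) ->
  exists w m n, [/\ Z w, \forall q \near p, C q -> q.2 = quadratic w m n q.1 &
    exists s e, [/\ s != 0, 0 < e & forall t, 0 < t < e ->
      C (p.1 + s * t, quadratic w m n (p.1 + s * t))]].
Proof.
move=> Cp nCp.
have [u [u1 [u2 [jet Cu]]]] := graphC Cp.
have /nbhs_ballP[e0 /= e00 jet0] := jet.
have cu : {for p.1, continuous u}.
  have [d _ _] := nbhs_singleton jet.
  by apply/differentiable_continuous/derivable1_diffP.
pose T := fun y => u p.1 + u1 p.1 * (y - p.1) + u2 p.1 / 2 * (y - p.1) ^+ 2.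
have TE : T =1 quadratic (u2 p.1) (u1 p.1 - u2 p.1 * p.1)
    (u p.1 - u1 p.1 * p.1 + u2 p.1 / 2 * p.1 ^+ 2).
  by move=> y; rewrite /T /quadratic; field.
have side s : s ^+ 2 = 1 -> exists2 e : R, 0 < e &
   [/\ Z (u2 p.1), forall t, 0 < t < e -> u (p.1 + s * t) = T (p.1 + s * t) &
     forall t, 0 < t < e -> C (p.1 + s * t, u (p.1 + s * t))] \/
    (forall t, 0 < t < e -> ~ C (p.1 + s * t, u (p.1 + s * t))).
  move=> s2; have ns := sqr1_norm s2.
  have [e e1 [good|bad]] := arc_dichotomy s2 conC Cp cu Cu; last first.
    by exists e => //; right.
  have m0 : 0 < Num.min e e0 by rewrite lt_min e1.
  exists (Num.min e e0) => //; left.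
  have [||Zu TT] := @arc_is_parabola u u1 u2 p.1 s _ s2 m0.
  - move=> t /andP[t0]; rewrite lt_min => /andP[_ te]; apply: jet0.
    by rewrite /ball/= opprD addrA subrr sub0r normrN normrM ns mul1r ger0_norm.
  - by move=> t /andP[t0]; rewrite lt_min => /andP[te _]; apply: good; rewrite t0.
  split=> // t /andP[t0 te].
    by rewrite TT ?te ?ltW// /T [_ + _ - _]addrAC subrr add0r.
  by apply: good; rewrite t0 (lt_le_trans te)// ge_min lexx.
have sq1 : 1 ^+ 2 = 1 :> R by rewrite expr1n.
have sqN1 : (-1) ^+ 2 = 1 :> R by rewrite sqrrN expr1n.
have [e e1 sp] := side _ sq1; have [e' e1' sn] := side _ sqN1.
have nearp : \forall q \near p, [/\ C q -> q.2 = u q.1,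
    - e' < q.1 - p.1 & q.1 - p.1 < e].
  have cq : {for p, continuous (fun q : R * R => q.1 - p.1)}.
    by apply: cvgB; [exact: cvg_fst|exact: cvg_cst].
  near=> q; split; near: q => //.
    by apply: (cvgr_gt _ cq); rewrite subrr oppr_lt0.
  by apply: (cvgr_lt _ cq); rewrite subrr.
have [bads|good] := pselect ((forall t, 0 < t < e -> ~ C (p.1 + 1 * t, u (p.1 + 1 * t))) /\
  (forall t, 0 < t < e' -> ~ C (p.1 + -1 * t, u (p.1 + -1 * t)))).
  have [bad badN] := bads.
  (* p is then isolated in C, hence the only point of C. *)
  have iso : \forall q \near p, C q -> q = p.
    apply: filterS nearp => q [qu q1 q2] Cq.
    have := qu Cq; case: q qu q1 q2 Cq => x y /= qu q1 q2 Cq yE; subst y.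
    have [xp|xp|xp] := ltgtP x p.1.
    - case: (badN (p.1 - x)); first by lra.
      by have -> : p.1 + -1 * (p.1 - x) = x by lra.
    - case: (bad (x - p.1)); first by lra.
      by have -> : p.1 + 1 * (x - p.1) = x by lra.
    - by rewrite xp -(nbhs_singleton Cu)//; case: (p).
  case: nCp; suff <- : [set p] = C by [].
  apply: conC; first by exists p.
  - exists ([set q | C q -> q = p]°); first exact: open_interior.
    apply/seteqP; split=> q; first by move=> /= ->.
    by move=> [Cq /interior_subset]; apply.
  - exists [set p]; first exact/accessible_closed_set1/hausdorff_accessible/norm_hausdorff.
    by apply/seteqP; split=> q; [move=> /= -> //|case].
exists (u2 p.1), (u1 p.1 - u2 p.1 * p.1),
  (u p.1 - u1 p.1 * p.1 + u2 p.1 / 2 * p.1 ^+ 2).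
split.
- by case: sp => [[]|b1]//; case: sn => [[]|b2]//; case: good.
- apply: filterS nearp => q [qu q1 q2] Cq; rewrite -TE.
  have := qu Cq; case: q qu q1 q2 Cq => x y /= qu q1 q2 Cq yE; subst y.
  have [xp|xp|xp] := ltgtP x p.1.
  + have xE : x = p.1 + -1 * (p.1 - x) by lra.
    rewrite xE; case: sn => [[_ -> //]|bad]; first lra.
    by case: (bad (p.1 - x)); [lra|rewrite -xE].
  + have xE : x = p.1 + 1 * (x - p.1) by lra.
    rewrite xE; case: sp => [[_ -> //]|bad]; first lra.
    by case: (bad (x - p.1)); [lra|rewrite -xE].
  + by rewrite xp /T subrr expr2 !mulr0 !addr0.
- case: sp => [[_ uT Cs]|b1].
    by exists 1, e; split => // t te; rewrite -TE -uT//; exact: Cs.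
  case: sn => [[_ uT Cs]|b2]; last by case: good.
  by exists (-1), e'; split => // t te; rewrite -TE -uT//; exact: Cs.
Unshelve. all: by end_near. Qed.

Lemma arc_inside p s e (f : R -> R) (D : set (R * R)) :
  s != 0 -> 0 < e -> {for p.1, continuous f} -> f p.1 = p.2 ->
  (\forall q \near p, D q) ->
  exists2 d, 0 < d < e & forall t, 0 < t <= d -> D (p.1 + s * t, f (p.1 + s * t)).
Proof.
move=> s0 e0 cf fp Dp.
have cl : {for (0 : R), continuous (fun t : R => (p.1 + s * t, f (p.1 + s * t)))}.
  have c1 : {for (0 : R), continuous (fun t : R => p.1 + s * t)}.
    by apply: cvgD; [exact: cvg_cst|apply: cvgM; [exact: cvg_cst|exact: cvg_id]].
  have c2 : {for (0 : R), continuous (f \o (fun t : R => p.1 + s * t))}.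
    by apply: continuous_comp; [exact: c1|rewrite mulr0 addr0].
  exact: cvg_pair c1 c2.
have /cl/nbhs_ballP[r /= r0 Dr] : nbhs (p.1 + s * 0, f (p.1 + s * 0)) D.
  by rewrite mulr0 addr0 fp; case: (p) Dp.
have m0 : 0 < Num.min e r by rewrite lt_min e0.
exists (Num.min e r / 2).
  rewrite divr_gt0//= ltr_pdivrMr//.
  by have : Num.min e r <= e by [rewrite ge_min lexx]; lra.
move=> t /andP[t0 td]; apply: Dr; rewrite /ball/= sub0r normrN ger0_norm ?ltW//.
by have : Num.min e r <= r by [rewrite ge_min lexx orbT]; lra.
Qed.

Lemma quadratic_continuous w m n : continuous (@quadratic R w m n).
Proof.
move=> y; apply: cvgD; last exact: cvg_cst.
apply: cvgD; apply: cvgM; try exact: cvg_cst; try exact: cvg_id.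
exact: exprn_continuous.
Qed.

(** Three distinct points determine a quadratic polynomial; the distances e, e/2
    and e/4 give a linear system in the coefficients relative to p1. *)
Lemma quadratic_eq_on_arc (p1 s e w m n w' m' n' : R) : s != 0 -> 0 < e ->
  (forall t, 0 < t <= e -> quadratic w m n (p1 + s * t) = quadratic w' m' n' (p1 + s * t)) ->
  quadratic w m n =1 quadratic w' m' n'.
Proof.
move=> s0 e0 qE.
have := qE e; have := qE (e / 2); have := qE (e / 4); rewrite /quadratic.
move=> /(_ ltac:(lra)) q4 /(_ ltac:(lra)) q2 /(_ ltac:(lra)) q1.
pose W := w - w'; pose M := m - m'; pose N := n - n'.
have [A2 [A1 A0]] : W * (s ^+ 2 * e ^+ 2) = 0 /\ (W * p1 + M) * (s * e) = 0 /\
    W / 2 * p1 ^+ 2 + M * p1 + N = 0.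
  by rewrite /W /M /N; lra.
have se : s * e != 0 by rewrite mulf_neq0 // gt_eqF.
have W0 : W = 0.
  by apply/eqP; move/eqP: A2; rewrite mulf_eq0 -exprMn sqrf_eq0 (negPf se) orbF.
have M0 : M = 0.
  by apply/eqP; move/eqP: A1; rewrite W0 mul0r add0r mulf_eq0 (negPf se) orbF.
have N0 : N = 0 by move: A0; rewrite W0 M0; lra.
by move: W0 M0 N0; rewrite /W /M /N => /subr0_eq -> /subr0_eq -> /subr0_eq ->.
Qed.

(** Analytic continuation: the points of C near which C lies on a given parabola
    form a relatively open set.  It is also relatively closed, because near a
    limit point C lies on a parabola sharing an arc with the given one. *)
Lemma connected_curve_on_parabola : (exists p, C `<=` [set p]) \/
  exists w m n, Z w /\ forall q, C q -> q.2 = quadratic w m n q.1.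
Proof.
have [ex1|nex1] := pselect (exists p, C `<=` [set p]); [by left|right].
have nC p : ~ (C `<=` [set p]) by move=> Cp; apply: nex1; exists p.
have [p0 Cp0] : C !=set0.
  by apply/set0P/negP => /eqP C0; apply: (nC (0, 0)); rewrite C0.
have [w [m [n [Zw q0 _]]]] := locally_parabola Cp0 (@nC p0).
exists w, m, n; split=> //.
pose E := [set q : R * R | C q -> q.2 = quadratic w m n q.1].
suff CE : C `&` E° = C by move=> q; rewrite -{1}CE => -[Cq /interior_subset]; apply.
apply: conC; first by exists p0.
  by exists E° => //; exact: open_interior.
exists (closure (C `&` E°)); first exact: closed_closure.
apply/seteqP; split=> p [Cp Ep]; split => //; first exact: subset_closure.
have [wp [mp [np [_ qp _]]]] := locally_parabola Cp (@nC p).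
have [p' [[Cp' Ep'] qp']] := Ep _ (nbhs_interior qp).
have [w' [m' [n' [_ q' [s [e [s0 e0 arc]]]]]]] := locally_parabola Cp' (@nC p').
have [d /andP[d0 de] DD] := arc_inside s0 e0 (@quadratic_continuous w' m' n' p'.1)
  (esym (nbhs_singleton q' Cp')) (filterI Ep' qp').
have TT : quadratic w m n =1 quadratic wp mp np.
  apply: (quadratic_eq_on_arc s0 d0) => t /andP[t0 td].
  have [D1 D2] := DD t ltac:(by rewrite t0).
  have Ct := arc t ltac:(by rewrite t0 (le_lt_trans td)).
  exact: etrans (esym (D1 Ct)) (D2 Ct).
by apply: filterS qp => q h Cq; rewrite h// TT.
Qed.

End ParabolicCurve.

(** * Binary quadratic forms and isotropic similarities *)

Lemma det_mx22 (A : comNzRingType) (M : 'M[A]_2) :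
  \det M = M 0 0 * M 1 1 - M 0 1 * M 1 0.
Proof.
have l1 : lift 0 0 = 1 :> 'I_2 by apply/val_inj.
have l0 : lift 1 0 = 0 :> 'I_2 by apply/val_inj.
rewrite (expand_det_row _ 0) !big_ord_recl big_ord0 /cofactor !det_mx11 !mxE.
by rewrite !l1 l0 /= expr0 expr1 mul1r mulN1r mulrN addr0.
Qed.

Lemma mxtrace22 (A : nzRingType) (M : 'M[A]_2) : \tr M = M 0 0 + M 1 1.
Proof.
have l1 : lift 0 0 = 1 :> 'I_2 by apply/val_inj.
by rewrite /mxtrace !big_ord_recl big_ord0 addr0 l1.
Qed.

Lemma char_poly22 (A : comNzRingType) (M : 'M[A]_2) :
  char_poly M = 'X^2 - (\tr M)%:P * 'X + (\det M)%:P.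
Proof.
rewrite /char_poly /char_poly_mx (det_mx22 M) [LHS]det_mx22 !mxE /= !mulr1n !mulr0n mxtrace22.
by rewrite polyCD polyCB !polyCM; ring.
Qed.

Lemma char_poly22_factor (A : comNzRingType) (M : 'M[A]_2) (k1 k2 : A) :
  char_poly M = ('X - k1%:P) * ('X - k2%:P) <->
  \tr M = k1 + k2 /\ \det M = k1 * k2.
Proof.
rewrite char_poly22; split=> [E|[-> ->]]; last first.
  by rewrite polyCD polyCM; ring.
have F : ('X - k1%:P) * ('X - k2%:P) = 'X^2 - (k1 + k2)%:P * 'X + (k1 * k2)%:P.
  by rewrite polyCD polyCM; ring.
rewrite F in E; split.
  have := congr1 (fun p : {poly A} => p`_1) E.
  by rewrite !coefD !coefN !coefXn !coefMX !coefC /= !addr0 !add0r => /oppr_inj.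
have := congr1 (fun p : {poly A} => p`_0) E.
by rewrite !coefD !coefN !coefXn !coefMX !coefC /= oppr0 !add0r.
Qed.

Lemma det_isotropic_mx (R : realType) (e : bool) (h1 h2 c1 c2 c3 : R) :
  \det (isotropic_mx e h1 h2 c1 c2 c3) = (-1) ^+ e * (h1 ^+ 2 + h2 ^+ 2) * c3.
Proof.
rewrite (expand_det_row _ 0) !big_ord_recl big_ord0 /cofactor !det_mx22 !mxE /=.
by rewrite /bump /= expr1 expr0; ring.
Qed.

Lemma isotropic_mxE (R : realType) (e : bool) (h1 h2 c1 c2 c3 : R) (b p : 'cV[R]_3) :
  let q := isotropic_mx e h1 h2 c1 c2 c3 *m p + b in
  [/\ xc q = (-1) ^+ e * (h1 * xc p - h2 * yc p) + xc b,
      yc q = h2 * xc p + h1 * yc p + yc b &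
      zc q = c1 * xc p + c2 * yc p + c3 * zc p + zc b].
Proof.
have l1 : lift 0 0 = 1 :> 'I_3 by apply/val_inj.
have l2 : lift 0 1 = 2 :> 'I_3 by apply/val_inj.
have l2' : lift 0 (lift 0 0) = 2 :> 'I_3 by apply/val_inj.
by split; rewrite /xc /yc /zc !mxE !big_ord_recl big_ord0 !mxE /= ?l1 ?l2 ?l2'; ring.
Qed.

Lemma vec3E (R : realType) (x y z : R) :
  ((xc (vec3 x y z) = x) * (yc (vec3 x y z) = y) * (zc (vec3 x y z) = z))%type.
Proof. by rewrite /xc /yc /zc !mxE. Qed.

Lemma vec3_eq (R : realType) (p q : 'cV[R]_3) :
  xc p = xc q -> yc p = yc q -> zc p = zc q -> p = q.
Proof.
rewrite /xc /yc /zc => x y z; apply/matrixP => i j; rewrite ord1.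
case: i => [[|[|[|]]]] //= i; move: x y z.
- by have -> : Ordinal i = 0 by exact/val_inj.
- by have -> : Ordinal i = 1 by exact/val_inj.
- by have -> : Ordinal i = 2 by exact/val_inj.
Qed.

Definition on_quadric (R : realType) (al be ga l m n : R) (p : 'cV[R]_3) :=
  zc p = (al * xc p ^+ 2 + 2 * be * xc p * yc p + ga * yc p ^+ 2) / 2
         + l * xc p + m * yc p + n.

(** The condition on the symmetric matrix with entries al, be, be, ga that its
    eigenvalues are nonzero and have ratio a or 1/a, expressed by its trace and
    determinant. *)
Definition ratio_form (R : realType) (a al be ga : R) :=
  a * (al + ga) ^+ 2 = (1 + a) ^+ 2 * (al * ga - be ^+ 2) /\
  al * ga - be ^+ 2 != 0.

(** Up to a scalar, the form is X^2 + a Y^2 in the coordinates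
    X = h1 x - h2 y, Y = h2 x + h1 y rotated to its eigenvectors. *)
Lemma ratio_form_diag (R : realType) (a al be ga : R) : a != 0 ->
  ratio_form a al be ga ->
  exists h1 h2 c, [/\ h1 ^+ 2 + h2 ^+ 2 != 0, c != 0,
    c * al = 2 * (h1 ^+ 2 + a * h2 ^+ 2), c * be = 2 * (a - 1) * h1 * h2 &
    c * ga = 2 * (h2 ^+ 2 + a * h1 ^+ 2)].
Proof.
move=> a0 [E D0].
have [be0|be0] := eqVneq be 0.
  move: D0; rewrite be0 expr0n subr0 mulf_eq0 negb_or => /andP[al0 ga0].
  have : (ga - a * al) * (al - a * ga) = 0 by move: E; rewrite be0; lra.
  move/eqP; rewrite mulf_eq0 => /orP[]/eqP F.
  - exists 1, 0, (2 / al); split.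
    + by rewrite expr1n expr0n addr0 oner_neq0.
    + by rewrite mulf_neq0// ?invr_eq0.
    + by field.
    + by ring.
    + by have -> : ga = a * al by [lra]; field.
  - exists 0, 1, (2 / ga); split.
    + by rewrite expr1n expr0n add0r oner_neq0.
    + by rewrite mulf_neq0// ?invr_eq0.
    + by have -> : al = a * ga by [lra]; field.
    + by ring.
    + by field.
(* la and a * la are the eigenvalues; for a = -1 the trace does not determine
   la, which is then a square root of the negative of the determinant. *)
have [la [la1 la2]] : exists la,
    la * (1 + a) = al + ga /\ a * la ^+ 2 = al * ga - be ^+ 2.
  have [a1|a1] := eqVneq (1 + a) 0; last first.
    exists ((al + ga) / (1 + a)); split; first by rewrite divfK.
    by rewrite expr_div_n mulrA E mulrAC divff ?mul1r// expf_neq0.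
  have aN : a = -1 by lra.
  have S0 : al + ga = 0.
    apply/eqP; rewrite -sqrf_eq0; apply/eqP; move: E; rewrite a1 aN; lra.
  exists (Num.sqrt (al ^+ 2 + be ^+ 2)); split; first by rewrite a1 S0 mulr0.
  rewrite sqr_sqrtr ?addr_ge0 ?sqr_ge0// aN; have -> : ga = - al by lra.
  ring.
have la0 : la != 0.
  by apply: contra D0 => /eqP l0; rewrite -la2 l0 expr0n mulr0.
have N0 : be ^+ 2 + (al - la) ^+ 2 != 0.
  by rewrite gt_eqF// ltr_wpDr ?sqr_ge0// exprn_even_gt0.
(* (be, la - al) is an eigenvector for la, nonzero as be is. *)
exists be, (al - la), (2 * (be ^+ 2 + (al - la) ^+ 2) / la).
have gaE : ga = la * (1 + a) - al by lra.
have be2 : be ^+ 2 = (al - la) * (a * la - al).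
  by have := la2; rewrite gaE; lra.
split.
- exact: N0.
- by rewrite !mulf_neq0// invr_eq0.
- apply: (mulfI la0).
  rewrite [LHS](_ : _ = 2 * (be ^+ 2 + (al - la) ^+ 2) * al); last by field.
  by rewrite be2; ring.
- apply: (mulfI la0).
  rewrite [LHS](_ : _ = 2 * (be ^+ 2 + (al - la) ^+ 2) * be); last by field.
  by rewrite be2; ring.
- apply: (mulfI la0).
  rewrite [LHS](_ : _ = 2 * (be ^+ 2 + (al - la) ^+ 2) * ga); last by field.
  by rewrite gaE be2; ring.
Qed.

Lemma sqr_signb (R : realType) (e : bool) : ((-1) ^+ e) ^+ 2 = 1 :> R.
Proof. by rewrite -exprM mulnC exprM sqrrN expr1n expr1n. Qed.

(** The last row of the similarity scales z by c and subtracts the linear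
    part. *)
Lemma quadric_isotropic_paraboloid (R : realType) (a al be ga l m n : R) :
  a != 0 -> ratio_form a al be ga ->
  exists2 g, isotropic_similarity g &
    forall p : 'cV[R]_3, on_quadric al be ga l m n p -> paraboloid a (g p).
Proof.
move=> a0 /(ratio_form_diag a0)[h1 [h2 [c [h0 c0 cal cbe cga]]]].
pose M := isotropic_mx false h1 h2 (- c * l) (- c * m) c.
exists (fun p => M *m p + vec3 0 0 (- c * n)).
  exists false, h1, h2, (- c * l), (- c * m), c, (vec3 0 0 (- c * n)).
  by rewrite unitmxE det_isotropic_mx expr0 mul1r unitfE mulf_neq0.
move=> p; rewrite /on_quadric /paraboloid /=.
have [-> -> ->] :=
  isotropic_mxE false h1 h2 (- c * l) (- c * m) c (vec3 0 0 (- c * n)) p.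
rewrite !vec3E => ->; rewrite expr0.
transitivity ((c * al) * xc p ^+ 2 / 2 + (c * be) * xc p * yc p
  + (c * ga) * yc p ^+ 2 / 2).
  by field.
by rewrite cal cbe cga; field.
Qed.

(** The coefficients come from expanding z' = x'^2 + a y'^2 in the original
    coordinates and solving for z. *)
Lemma paraboloid_pullback_quadric (R : realType) (a : R) g :
  isotropic_similarity g ->
  exists k al be ga l m n, [/\ k != 0, al + ga = k + a * k,
    al * ga - be ^+ 2 = k * (a * k) &
    forall p : 'cV[R]_3, paraboloid a (g p) -> on_quadric al be ga l m n p].
Proof.
move=> [e [h1 [h2 [c1 [c2 [c3 [b [u gE]]]]]]]].
move: u; rewrite unitmxE det_isotropic_mx unitfE !mulf_eq0 !negb_or.
rewrite signr_eq0 /= => /andP[h0 c30].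
have s2 := sqr_signb R e; set s : R := (-1) ^+ e in s2.
exists (2 * (h1 ^+ 2 + h2 ^+ 2) / c3), (2 * (h1 ^+ 2 + a * h2 ^+ 2) / c3),
  (2 * (a - 1) * h1 * h2 / c3), (2 * (h2 ^+ 2 + a * h1 ^+ 2) / c3),
  ((2 * s * h1 * xc b + 2 * a * h2 * yc b - c1) / c3),
  ((- 2 * s * h2 * xc b + 2 * a * h1 * yc b - c2) / c3),
  ((xc b ^+ 2 + a * yc b ^+ 2 - zc b) / c3).
split.
- by rewrite !mulf_neq0// invr_eq0.
- by field.
- by field.
move=> p; rewrite /on_quadric /paraboloid /= gE.
have [-> -> ->] := isotropic_mxE e h1 h2 c1 c2 c3 b p; rewrite -/s.
rewrite [(_ + xc b) ^+ 2](_ : _ = s ^+ 2 * (h1 * xc p - h2 * yc p) ^+ 2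
  + 2 * s * (h1 * xc p - h2 * yc p) * xc b + xc b ^+ 2); last by ring.
rewrite s2 => E; apply: (mulfI c30).
rewrite (_ : c3 * zc p = c1 * xc p + c2 * yc p + c3 * zc p + zc b
  - (c1 * xc p + c2 * yc p + zc b)); last by ring.
by rewrite E; field.
Qed.

(** A congruence rotates (or reflects) the quadratic part, which preserves its
    trace and determinant. *)
Lemma congruence_quadric (R : realType) (a al be ga l m n : R) g :
  isotropic_congruence g -> ratio_form a al be ga ->
  exists al' be' ga' l' m' n', ratio_form a al' be' ga' /\
  forall p : 'cV[R]_3, on_quadric al be ga l m n p ->
    on_quadric al' be' ga' l' m' n' (g p).
Proof.
move=> [e [phi [c1 [c2 [b gE]]]]] rf.
have s2 := sqr_signb R e; set s : R := (-1) ^+ e in s2.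
have cs := cos2Dsin2 phi.
set c := cos phi in gE cs; set d := sin phi in gE cs.
pose l1 := l + c1; pose m1 := m + c2; pose n1 := n + zc b.
pose al' := al * c ^+ 2 - 2 * be * c * d + ga * d ^+ 2.
pose ga' := al * d ^+ 2 + 2 * be * c * d + ga * c ^+ 2.
pose be' := s * (al * c * d + be * (c ^+ 2 - d ^+ 2) - ga * c * d).
(* (u, v) is the rotated translation vector. *)
pose u := s * c * xc b + d * yc b; pose v := - s * d * xc b + c * yc b.
exists al', be', ga',
 (- al * u * s * c - be * v * s * c + be * u * s * d + ga * v * s * d
  + l1 * s * c - m1 * s * d),
 (- al * u * d - be * v * d - be * u * c - ga * v * c + l1 * d + m1 * c),
 ((al * u ^+ 2 + 2 * be * u * v + ga * v ^+ 2) / 2 - l1 * u - m1 * v + n1).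
split.
  have tr : al' + ga' = al + ga.
    transitivity ((al + ga) * (c ^+ 2 + d ^+ 2)); last by rewrite cs mulr1.
    by rewrite /al' /ga'; ring.
  have dt : al' * ga' - be' ^+ 2 = al * ga - be ^+ 2.
    transitivity ((al * ga - be ^+ 2) * (c ^+ 2 + d ^+ 2) ^+ 2); last first.
      by rewrite cs expr1n mulr1.
    by rewrite /be' exprMn s2 /al' /ga'; ring.
  by case: rf; rewrite /ratio_form tr dt.
move=> p; rewrite /on_quadric gE.
have [] := isotropic_mxE e c d c1 c2 1 b p; rewrite -/s.
set X := xc (_ + b); set Y := yc (_ + b); set W := zc (_ + b) => XE YE -> zE.
have xE : xc p = s * c * X + d * Y - u.
  transitivity (xc p * (c ^+ 2 + d ^+ 2)); first by rewrite cs mulr1.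
  transitivity (s ^+ 2 * c * (c * xc p - d * yc p) + d * (d * xc p + c * yc p)).
    by rewrite s2; ring.
  by rewrite XE YE /u; ring.
have yE : yc p = - s * d * X + c * Y - v.
  transitivity (yc p * (c ^+ 2 + d ^+ 2)); first by rewrite cs mulr1.
  transitivity (- s ^+ 2 * d * (c * xc p - d * yc p) + c * (d * xc p + c * yc p)).
    by rewrite s2; ring.
  by rewrite XE YE /v; ring.
rewrite mul1r zE xE yE.
(* The squares of the sign s are exhibited before they are replaced by 1. *)
rewrite [LHS](_ : _ = (al * (s ^+ 2 * c ^+ 2 * X ^+ 2 + 2 * s * c * X * (d * Y - u)
    + (d * Y - u) ^+ 2)
  + 2 * be * (- s ^+ 2 * c * d * X ^+ 2 + s * c * X * (c * Y - v)
    - s * d * X * (d * Y - u) + (d * Y - u) * (c * Y - v))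
  + ga * (s ^+ 2 * d ^+ 2 * X ^+ 2 - 2 * s * d * X * (c * Y - v)
    + (c * Y - v) ^+ 2)) / 2
  + l1 * (s * c * X + d * Y - u) + m1 * (- s * d * X + c * Y - v) + n1); last first.
  by rewrite /l1 /m1 /n1; field.
by rewrite s2 /al' /be' /ga'; field.
Qed.

(** * Quadratic graphs have a constant Hessian *)

Section Polynomials.
Context {R : realType}.
Implicit Types (q v : 'cV[R]_2).

Definition affine_fun (l m n : R) q : R := l * q 0 0 + m * q 1 0 + n.

Definition quadratic_fun (al be ga l m n : R) q : R :=
  (al * q 0 0 ^+ 2 + 2 * be * q 0 0 * q 1 0 + ga * q 1 0 ^+ 2) / 2
  + l * q 0 0 + m * q 1 0 + n.

Lemma is_derive_coord (i : 'I_2) q v : is_derive q v (fun p => p i 0 : R) (v i 0).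
Proof.
have @f : {linear 'cV[R]_2 -> R}.
  by exists (fun N : 'cV[R]_2 => N i 0); do 2![eexists]; do ?[constructor];
     rewrite ?mxE// => ? *; rewrite ?mxE//; move=> ?; rewrite !mxE.
have df := differentiable_coord q i 0.
apply: DeriveDef; first exact: diff_derivable.
rewrite deriveE// -[(fun p => _)]/(f : _ -> _) diff_lin//.
exact: coord_continuous.
Qed.

Lemma affine_fun_is_derive l m n q v :
  is_derive q v (affine_fun l m n) (l * v 0 0 + m * v 1 0).
Proof.
have -> : affine_fun l m n = l *: (fun p : 'cV[R]_2 => p 0 0 : R) +
    m *: (fun p : 'cV[R]_2 => p 1 0 : R) + cst n by [].
have d0 := is_derive_coord 0 q v; have d1 := is_derive_coord 1 q v.
apply: (is_derive_eq (is_deriveD (is_deriveD (is_deriveZ l d0)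
  (is_deriveZ m d1)) (is_derive_cst n q v))).
by rewrite addr0.
Qed.

Lemma quadratic_fun_is_derive al be ga l m n q v :
  is_derive q v (quadratic_fun al be ga l m n)
    (affine_fun (al * v 0 0 + be * v 1 0) (be * v 0 0 + ga * v 1 0)
                (l * v 0 0 + m * v 1 0) q).
Proof.
pose X := fun p : 'cV[R]_2 => p 0 0 : R; pose Y := fun p : 'cV[R]_2 => p 1 0 : R.
have -> : quadratic_fun al be ga l m n =
    (al / 2) *: (X * X) + be *: (X * Y) + (ga / 2) *: (Y * Y)
    + l *: X + m *: Y + cst n.
  apply/funext => p; rewrite /quadratic_fun.
  rewrite -[RHS]/(al / 2 * (p 0 0 * p 0 0) + be * (p 0 0 * p 1 0)
    + ga / 2 * (p 1 0 * p 1 0) + l * p 0 0 + m * p 1 0 + n).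
  by field.
have d0 : is_derive q v X (v 0 0) by exact: is_derive_coord.
have d1 : is_derive q v Y (v 1 0) by exact: is_derive_coord.
have H := is_deriveD (is_deriveD (is_deriveD (is_deriveD (is_deriveD
  (is_deriveZ (al / 2) (is_deriveM d0 d0)) (is_deriveZ be (is_deriveM d0 d1)))
  (is_deriveZ (ga / 2) (is_deriveM d1 d1))) (is_deriveZ l d0)) (is_deriveZ m d1))
  (is_derive_cst n q v).
apply: (is_derive_eq H); rewrite addr0 /affine_fun /GRing.scale /= /X /Y.
by field.
Qed.

Lemma affine_fun_differentiable l m n q : differentiable (affine_fun l m n) q.
Proof.
have d0 := differentiable_coord q 0 0; have d1 := differentiable_coord q 1 0.
have -> : affine_fun l m n = l *: (fun p : 'cV[R]_2 => p 0 0 : R) +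
    m *: (fun p : 'cV[R]_2 => p 1 0 : R) + cst n by [].
exact: (differentiableD (differentiableD (differentiableZ l d0)
  (differentiableZ m d1)) (differentiable_cst n q)).
Qed.

Lemma quadratic_fun_differentiable al be ga l m n q :
  differentiable (quadratic_fun al be ga l m n) q.
Proof.
have -> : quadratic_fun al be ga l m n =
   affine_fun (al / 2) 0 0 * affine_fun 1 0 0 + affine_fun be 0 0 * affine_fun 0 1 0
   + affine_fun 0 (ga / 2) 0 * affine_fun 0 1 0 + affine_fun l m n.
  apply/funext => p; rewrite /quadratic_fun.
  rewrite -[RHS]/(affine_fun (al / 2) 0 0 p * affine_fun 1 0 0 p
    + affine_fun be 0 0 p * affine_fun 0 1 0 p
    + affine_fun 0 (ga / 2) 0 p * affine_fun 0 1 0 p + affine_fun l m n p).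
  by rewrite /affine_fun; field.
have d l' m' n' := affine_fun_differentiable l' m' n' q.
have dM l1 m1 n1 l2 m2 n2 := differentiableM (d l1 m1 n1) (d l2 m2 n2).
exact: (differentiableD (differentiableD (differentiableD (dM _ _ _ _ _ _)
  (dM _ _ _ _ _ _)) (dM _ _ _ _ _ _)) (d _ _ _)).
Qed.

Lemma derive_quadratic_fun al be ga l m n v :
  'D_v (quadratic_fun al be ga l m n) =
  affine_fun (al * v 0 0 + be * v 1 0) (be * v 0 0 + ga * v 1 0) (l * v 0 0 + m * v 1 0).
Proof. by apply/funext => q; have [_ ->] := quadratic_fun_is_derive al be ga l m n q v. Qed.

Lemma derive_affine_fun l m n v : 'D_v (affine_fun l m n) = cst (l * v 0 0 + m * v 1 0).
Proof. by apply/funext => q; have [_ ->] := affine_fun_is_derive l m n q v. Qed.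

Lemma quadratic_fun_class_C3 al be ga l m n :
  class_C 3 setT (quadratic_fun al be ga l m n).
Proof.
split=> [x _|v]; first exact: quadratic_fun_differentiable.
rewrite derive_quadratic_fun; split=> [x _|w]; first exact: affine_fun_differentiable.
rewrite derive_affine_fun; split=> [x _|w' x _] //.
have -> : 'D_w' (cst ((al * v 0 0 + be * v 1 0) * w 0 0
    + (be * v 0 0 + ga * v 1 0) * w 1 0)) = cst (0 : R).
  by apply/funext => q; rewrite derive_cst.
exact: cst_continuous.
Qed.

Lemma hessian_quadratic_fun al be ga l m n q :
  \tr (hessian (quadratic_fun al be ga l m n) q) = al + ga /\
  \det (hessian (quadratic_fun al be ga l m n) q) = al * ga - be ^+ 2.
Proof.
rewrite det_mx22 mxtrace22 !mxE !derive_quadratic_fun.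
have dE l' m' n' w : 'D_w (affine_fun l' m' n') q = l' * w 0 0 + m' * w 1 0.
  by have [_ ->] := affine_fun_is_derive l' m' n' q w.
rewrite !dE !mxE /=.
by split; ring.
Qed.

Lemma on_quadric_local_graph (S : set 'cV[R]_3) p al be ga l m n :
  (forall p, S p -> on_quadric al be ga l m n p) ->
  local_graph S p (quadratic_fun al be ga l m n).
Proof.
move=> Sq; split.
  exists setT; split=> //; [exact: openT|exact: quadratic_fun_class_C3].
near=> q => /Sq; rewrite /on_quadric /quadratic_fun => ->.
by rewrite !mxE.
Unshelve. all: by end_near. Qed.

Lemma paraboloid_constant_ratio (a : R) (S P : set 'cV[R]_3) :
  a != 0 -> P `<=` paraboloid a -> isotropic_similar S P -> constant_ratio a S.
Proof.
move=> a0 Pa [g gs gS].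
have [k [al [be [ga [l [m [n [k0 tr dt quad]]]]]]]] := paraboloid_pullback_quadric a gs.
move=> p Sp; exists k, (a * k); split.
- exists (quadratic_fun al be ga l m n); split.
    apply: on_quadric_local_graph => q Sq; apply: quad; apply: Pa; rewrite -gS.
    by exists q.
  apply/char_poly22_factor; have [-> ->] := hessian_quadratic_fun al be ga l m n (xy p).
  by [].
- by rewrite !mulf_neq0.
- by right; rewrite mulfK.
Qed.
End Polynomials.

(** * Second derivatives in a moved frame *)

Lemma line_is_derive (R : realType) (V : normedModType R) (h : V -> R)
    (w v : V) (t d : R) :
  is_derive (w + t *: v) v h d <->
  is_derive t (1 : R) (fun s : R => h (w + s *: v)) d.
Proof.
have E : (fun s : R => s^-1 *: (h (s *: v + (w + t *: v)) - h (w + t *: v))) =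
    (fun s : R => s^-1 *: (h (w + (s *: (1 : R) + t) *: v) - h (w + t *: v))).
  apply/funext => s; congr (_ *: (h _ - _)).
  by rewrite scalerDl [s *: 1]mulr1 addrCA.
have D : derivable h (w + t *: v) v <-> derivable (fun s : R => h (w + s *: v)) t (1 : R).
  by rewrite /derivable /= E.
have DE : 'D_v h (w + t *: v) = 'D_(1 : R) (fun s : R => h (w + s *: v)) t.
  by rewrite /derive /= E.
split=> -[dh dE].
- by apply: DeriveDef; [exact: D.1 dh|rewrite -DE].
- by apply: DeriveDef; [exact: D.2 dh|rewrite DE].
Qed.

Lemma derive_cV2 (R : realType) (h : 'cV[R]_2 -> R) (p v : 'cV[R]_2) :
  differentiable h p ->
  'D_v h p = v 0 0 * 'D_(delta_mx 0 0) h p + v 1 0 * 'D_(delta_mx 1 0) h p.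
Proof.
move=> dh; rewrite !deriveE//.
have {1}-> : v = v 0 0 *: delta_mx 0 0 + v 1 0 *: delta_mx 1 0.
  apply/matrixP => i j; rewrite ord1.
  have [->|->] : i = 0 \/ i = 1.
  - by case: i => [[|[|]]] //= i; [left|right]; exact/val_inj.
  - by rewrite !mxE /= mulr1 mulr0 addr0.
  - by rewrite !mxE /= mulr1 mulr0 add0r.
by rewrite linearD !linearZ.
Qed.

Lemma derive2_hessian (R : realType) (h : 'cV[R]_2 -> R) (U : set 'cV[R]_2)
    (p v w : 'cV[R]_2) :
  open U -> U p -> class_C 3 U h ->
  'D_w ('D_v h) p =
    v 0 0 * (w 0 0 * hessian h p 0 0 + w 1 0 * hessian h p 0 1) +
    v 1 0 * (w 0 0 * hessian h p 1 0 + w 1 0 * hessian h p 1 1).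
Proof.
move=> oU Up [dh dDh].
have dd k : differentiable ('D_(delta_mx k 0) h) p by have [+ _] := dDh (delta_mx k 0); apply.
have E : \forall q \near p, 'D_v h q =
   (v 0 0 *: 'D_(delta_mx 0 0) h + v 1 0 *: 'D_(delta_mx 1 0) h) q.
  have : \forall q \near p, U q by exact: open_nbhs_nbhs.
  by apply: filterS => q Uq; rewrite derive_cV2//; exact: dh.
rewrite (near_eq_derive w E) deriveD; try by apply/derivableZ/diff_derivable.
rewrite !deriveZ; try by apply/diff_derivable.
by rewrite !mxE [in LHS](derive_cV2 w (dd 0)) (derive_cV2 w (dd 1)).
Qed.

(** In the frame B1, B2 the function h is x^2/2 + b x y + u(y) plus a linear
    function.  Each derivative is computed along a coordinate line, where it is
    the derivative of an explicit function of one variable; the first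
    derivatives are obtained on a neighbourhood so as to be differentiated
    again. *)
Lemma second_derivatives_translational (R : realType) (h : 'cV[R]_2 -> R)
    (B1 B2 o : 'cV[R]_2) (c1 c2 b n : R) (u u1 u2 : R -> R) (y0 : R) :
  C2_jet u u1 u2 y0 ->
  (\forall z \near ((0 : R), y0), h (o + z.1 *: B1 + z.2 *: B2) =
     z.1 ^+ 2 / 2 + b * z.1 * z.2 + u z.2 + c1 * z.1 + c2 * z.2 + n) ->
  let p := o + y0 *: B2 in
  [/\ 'D_B1 ('D_B1 h) p = 1, 'D_B2 ('D_B1 h) p = b,
      'D_B1 ('D_B2 h) p = b & 'D_B2 ('D_B2 h) p = u2 y0].
Proof.
move=> jet hE p.
have xline (x y : R) (D : set (R * R)) : (\forall z \near (x, y), D z) ->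
    \forall s \near x, D (s, y).
  have i1 : s @[s --> x] --> x by exact: cvg_id.
  have i2 : (fun _ : R => y) @ x --> y by exact: cvg_cst.
  by move=> /(cvg_pair i1 i2).
have yline (x y : R) (D : set (R * R)) : (\forall z \near (x, y), D z) ->
    \forall s \near y, D (x, s).
  have i1 : s @[s --> y] --> y by exact: cvg_id.
  have i2 : (fun _ : R => x) @ y --> x by exact: cvg_cst.
  by move=> /(cvg_pair i2 i1).
have oE (x y : R) : o + x *: B1 + y *: B2 = o + y *: B2 + x *: B1 by rewrite addrAC.
have D1 : \forall z \near ((0 : R), y0),
    'D_B1 h (o + z.1 *: B1 + z.2 *: B2) = z.1 + b * z.2 + c1.
  apply: filterS (near_join hE) => -[x y] /= hxy.
  suff [] : is_derive (o + x *: B1 + y *: B2) B1 h (x + b * y + c1) by [].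
  rewrite oE; apply/line_is_derive.
  apply: near_eq_is_derive (is_derive_eq
    (quadratic_is_derive 1 (b * y + c1) (u y + c2 * y + n) x) _); last by ring.
  by apply: filterS (xline _ _ _ hxy) => s; rewrite oE => ->; rewrite /quadratic /=; field.
have D2 : \forall z \near ((0 : R), y0),
    'D_B2 h (o + z.1 *: B1 + z.2 *: B2) = b * z.1 + u1 z.2 + c2.
  have jet' : \forall z \near ((0 : R), y0), is_derive z.2 (1 : R) u (u1 z.2).
    have i2 : snd @ ((0 : R), y0) --> y0 by exact: cvg_snd.
    by apply: (i2 [set y | is_derive y (1 : R) u (u1 y)]); apply: filterS jet => y [].
  apply: filterS2 (near_join hE) jet' => -[x y] /= hxy du.
  suff [] : is_derive (o + x *: B1 + y *: B2) B2 h (b * x + u1 y + c2) by [].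
  apply/line_is_derive.
  apply: near_eq_is_derive (is_derive_eq (is_deriveD
    (quadratic_is_derive 0 (b * x + c2) (x ^+ 2 / 2 + c1 * x + n) y) du) _); last by ring.
  apply: filterS (yline _ _ _ hxy) => s -> /=.
  rewrite -[LHS]/(quadratic 0 (b * x + c2) (x ^+ 2 / 2 + c1 * x + n) s + u s).
  by rewrite /quadratic; field.
have pE : p = o + y0 *: B2 + 0 *: B1 by rewrite scale0r addr0.
have pE' : p = o + 0 *: B1 + y0 *: B2 by rewrite scale0r addr0.
split.
- suff [] : is_derive p B1 ('D_B1 h) 1 by [].
  rewrite pE; apply/line_is_derive.
  apply: near_eq_is_derive (is_derive_eq
    (quadratic_is_derive 0 1 (b * y0 + c1) 0) _); last by ring.
  by apply: filterS (xline _ _ _ D1) => s; rewrite oE => ->; rewrite /quadratic /=; field.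
- suff [] : is_derive p B2 ('D_B1 h) b by [].
  rewrite pE'; apply/line_is_derive.
  apply: near_eq_is_derive (is_derive_eq
    (quadratic_is_derive 0 b c1 y0) _); last by ring.
  by apply: filterS (yline _ _ _ D1) => s ->; rewrite /quadratic /=; field.
- suff [] : is_derive p B1 ('D_B2 h) b by [].
  rewrite pE; apply/line_is_derive.
  apply: near_eq_is_derive (is_derive_eq
    (quadratic_is_derive 0 b (u1 y0 + c2) 0) _); last by ring.
  by apply: filterS (xline _ _ _ D2) => s; rewrite oE => ->; rewrite /quadratic /=; field.
- suff [] : is_derive p B2 ('D_B2 h) (u2 y0) by [].
  rewrite pE'; apply/line_is_derive.
  have [_ du1 _] := nbhs_singleton jet.
  apply: near_eq_is_derive (is_derive_eq (is_deriveD
    (is_derive_cst c2 y0 1) du1) _); last by rewrite add0r.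
  apply: filterS (yline _ _ _ D2) => s -> /=.
  rewrite -[LHS]/(c2 + u1 s).
  by ring.
Qed.

Definition vec2 (R : realType) (x y : R) : 'cV[R]_2 := \col_i [:: x; y]`_i.

(** Trace and determinant of the Hessian can be computed in any orthonormal
    frame; s is the sign of its orientation. *)
Lemma hessian_orthonormal_frame (R : realType) (h : 'cV[R]_2 -> R) U p (s c d : R) :
  open U -> U p -> class_C 3 U h -> s ^+ 2 = 1 -> c ^+ 2 + d ^+ 2 = 1 ->
  let B1 := vec2 (s * c) d in let B2 := vec2 (- (s * d)) c in
  \tr (hessian h p) = 'D_B1 ('D_B1 h) p + 'D_B2 ('D_B2 h) p /\
  \det (hessian h p) = 'D_B1 ('D_B1 h) p * 'D_B2 ('D_B2 h) p
                     - 'D_B2 ('D_B1 h) p * 'D_B1 ('D_B2 h) p.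
Proof.
move=> oU Up Ch s2 cd B1 B2; rewrite det_mx22 mxtrace22.
rewrite !(derive2_hessian _ _ oU Up Ch).
have -> : B1 0 0 = s * c by rewrite mxE.
have -> : B1 1 0 = d by rewrite mxE.
have -> : B2 0 0 = - (s * d) by rewrite mxE.
have -> : B2 1 0 = c by rewrite mxE.
move: (hessian h p 0 0) (hessian h p 0 1) (hessian h p 1 0) (hessian h p 1 1).
move=> m00 m01 m10 m11.
split.
  transitivity ((c ^+ 2 + d ^+ 2) * (s ^+ 2 * m00 + m11)); last by ring.
  by rewrite cd s2; ring.
transitivity ((m00 * m11 - m01 * m10) * s ^+ 2 * (c ^+ 2 + d ^+ 2) ^+ 2); last by ring.
by rewrite cd s2 expr1n !mulr1.
Qed.

(** * The profile of a parabolic rotational surface *)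

Lemma cvg_vec3 (R : realType) (T : Type) (F : set_system T) {FF : Filter F}
    (X Y Z : T -> R) (x y z : R) :
  X @ F --> x -> Y @ F --> y -> Z @ F --> z ->
  vec3 (X t) (Y t) (Z t) @[t --> F] --> vec3 x y z.
Proof.
have E (a b c : R) : vec3 a b c = a *: vec3 1 0 0 + b *: vec3 0 1 0 + c *: vec3 0 0 1.
  by apply: vec3_eq; rewrite /xc /yc /zc !mxE /= ?mulr1 ?mulr0 ?addr0 ?add0r.
move=> cX cY cZ; rewrite E; under eq_fun do rewrite E.
by apply: cvgD; [apply: cvgD|]; apply: cvgZr_tmp.
Qed.

(* Neighbourhoods of a column vector are seen by inference through the matrix
   structure, for which the filter property must be supplied. *)
#[local] Instance col_nbhs_filter (R : realType) n (p : 'cV[R]_n) : ProperFilter (nbhs p).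
Proof. exact: nbhs_pfilter. Qed.

Lemma continuous_coord3 (R : realType) :
  [/\ continuous (@xc R), continuous (@yc R) & continuous (@zc R)].
Proof. by split=> p; exact: coord_continuous. Qed.

Lemma continuous_isotropic (R : realType) e (h1 h2 c1 c2 c3 : R) (b : 'cV[R]_3) :
  continuous (fun p => isotropic_mx e h1 h2 c1 c2 c3 *m p + b).
Proof.
set g := fun p => _.
have -> : g = fun p => vec3 ((-1) ^+ e * (h1 * xc p - h2 * yc p) + xc b)
   (h2 * xc p + h1 * yc p + yc b) (c1 * xc p + c2 * yc p + c3 * zc p + zc b).
  apply/funext => p; rewrite /g.
  have [x y z] := isotropic_mxE e h1 h2 c1 c2 c3 b p.
  by apply: vec3_eq; rewrite ?x ?y ?z vec3E.
have [cx cy cz] := continuous_coord3 R.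
have k (a : R) (f : 'cV[R]_3 -> R) p : {for p, continuous f} ->
    (fun q => a * f q) @ p --> a * f p.
  by move=> cf; exact: cvgMl_tmp.
move=> p; apply: cvg_vec3.
- apply: cvgD; last exact: cvg_cst.
  apply: (k _ (fun q => h1 * xc q - h2 * yc q)).
  exact: cvgB (k _ _ _ (cx p)) (k _ _ _ (cy p)).
- apply: cvgD; last exact: cvg_cst.
  exact: cvgD (k _ _ _ (cx p)) (k _ _ _ (cy p)).
- apply: cvgD; last exact: cvg_cst.
  exact: cvgD (cvgD (k _ _ _ (cx p)) (k _ _ _ (cy p))) (k _ _ _ (cz p)).
Qed.

Section Profile.
Context {R : realType} (S0 : set 'cV[R]_3) (b : R).
Hypothesis conS0 : connected S0.
Hypothesis invS0 : forall t, parabolic_rotation b t @` S0 = S0.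

Definition profile : set (R * R) := [set q | S0 (vec3 0 q.1 q.2)].

(** The point of the plane x = 0 to which a parabolic rotation moves p, namely
    the one with parameter - xc p. *)
Definition profile_point (p : 'cV[R]_3) : R * R :=
  (yc p, zc p - xc p ^+ 2 / 2 - b * xc p * yc p).

Lemma profileP p : profile (profile_point p) <-> S0 p.
Proof.
rewrite /profile /=; split=> Sp.
  rewrite -(invS0 (xc p)).
  exists (vec3 0 (yc p) (zc p - xc p ^+ 2 / 2 - b * xc p * yc p)) => //.
  by apply: vec3_eq; rewrite /parabolic_rotation !vec3E; field.
rewrite -(invS0 (- xc p)); exists p => //.
by apply: vec3_eq; rewrite /parabolic_rotation !vec3E; field.
Qed.

Lemma connected_profile : connected profile.
Proof.
have -> : profile = profile_point @` S0.
  apply/seteqP; split=> [[y z] Cyz|_ [p /profileP Sp <-]//].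
  exists (vec3 0 y z) => //; rewrite /profile_point !vec3E.
  by congr pair; field.
apply: connected_continuous_connected => //.
apply: continuous_subspaceT => p.
have [cx cy cz] := continuous_coord3 R.
have := cx p; have := cy p; have := cz p; rewrite /continuous_at => z y x.
exact: cvg_pair y (cvgB (cvgB z (cvgMr_tmp (cvgM x x))) (cvgM (cvgMl_tmp x) y)).
Qed.

Variables (e : bool) (c d c1 c2 : R) (o : 'cV[R]_3).
Hypothesis cd1 : c ^+ 2 + d ^+ 2 = 1.
Let g := fun p => isotropic_mx e c d c1 c2 1 *m p + o.
Let s : R := (-1) ^+ e.
Let B1 := vec2 (s * c) d.
Let B2 := vec2 (- (s * d)) c.

Lemma xy_congruence p : xy (g p) = xy o + xc p *: B1 + yc p *: B2.
Proof.
have [x y _] := isotropic_mxE e c d c1 c2 1 o p.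
apply/matrixP => i j; rewrite ord1.
have [->|->] : i = 0 \/ i = 1.
- by case: i => [[|[|]]] //= i; [left|right]; exact/val_inj.
- by rewrite !mxE /= x -/s; ring.
- by rewrite !mxE /= y; ring.
Qed.

Lemma zc_congruence p : zc (g p) = zc p + c1 * xc p + c2 * yc p + zc o.
Proof.
have [_ _ z] := isotropic_mxE e c d c1 c2 1 o p.
by rewrite z; ring.
Qed.

(** A local graph f of the moved surface restricts to the profile: the plane
    x = 0 is moved to a plane over the line through xy o with direction B2. *)
Lemma profile_locally_graph p : profile p ->
  (exists f, local_graph (g @` S0) (g (vec3 0 p.1 p.2)) f) ->
  exists u u1 u2, C2_jet u u1 u2 p.1 /\
  \forall q \near p, profile q -> q.2 = u q.1.
Proof.
move=> Cp [f [[U [oU Up Cf]] gr]].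
have [df Ddf] := Cf; have [dDf DDdf] := Ddf B2; have [dDDf _] := DDdf B2.
exists (fun y => f (xy o + y *: B2) - quadratic 0 c2 (zc o) y),
  (fun y => 'D_B2 f (xy o + y *: B2) - c2), (fun y => 'D_B2 ('D_B2 f) (xy o + y *: B2)).
have gE y z : xy (g (vec3 0 y z)) = xy o + y *: B2.
  by rewrite xy_congruence !vec3E scale0r addr0.
have cl : continuous (fun y : R => xy o + y *: B2).
  by move=> y; apply: cvgD; [exact: cvg_cst|apply: cvgZr_tmp; exact: cvg_id].
split.
  have : \forall y \near p.1, U (xy o + y *: B2).
    by apply: cl; apply: open_nbhs_nbhs; split=> //; rewrite -(gE p.1 p.2).
  apply: filterS => y Uy; split.
  - have h := (line_is_derive f (xy o) B2 y _).1 (derivableP (diff_derivable (df _ Uy))).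
    have -> : (fun y => f (xy o + y *: B2) - quadratic 0 c2 (zc o) y) =
      (fun y => f (xy o + y *: B2)) - quadratic 0 c2 (zc o) by [].
    apply: (is_derive_eq (is_deriveB h (quadratic_is_derive 0 c2 (zc o) y))).
    by rewrite mul0r add0r.
  - have h := (line_is_derive ('D_B2 f) (xy o) B2 y _).1 (derivableP (diff_derivable (dDf _ Uy))).
    have -> : (fun y => 'D_B2 f (xy o + y *: B2) - c2) =
      (fun y => 'D_B2 f (xy o + y *: B2)) - cst c2 by [].
    by apply: (is_derive_eq (is_deriveB h (is_derive_cst c2 y 1))); rewrite subr0.
  - apply: (@continuous_comp _ _ _ (fun y : R => xy o + y *: B2) ('D_B2 ('D_B2 f))).
      exact: cl.
    exact/differentiable_continuous/dDDf.
have cG : g (vec3 0 q.1 q.2) @[q --> p] --> g (vec3 0 p.1 p.2).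
  have cv : vec3 (0 : R) q.1 q.2 @[q --> p] --> vec3 (0 : R) p.1 p.2.
    by apply: cvg_vec3; [exact: cvg_cst|exact: cvg_fst|exact: cvg_snd].
  have cg := @continuous_isotropic R e c d c1 c2 1 o (vec3 0 p.1 p.2).
  exact: (cvg_comp _ g cv cg).
have grG : \forall q \near p, (g @` S0) (g (vec3 0 q.1 q.2)) ->
  zc (g (vec3 0 q.1 q.2)) = f (xy (g (vec3 0 q.1 q.2))) by exact: cG gr.
apply: filterS grG => q h Cq.
have : zc (g (vec3 0 q.1 q.2)) = f (xy (g (vec3 0 q.1 q.2))).
  by apply: h; exists (vec3 0 q.1 q.2).
by rewrite gE zc_congruence !vec3E /quadratic => <-; ring.
Qed.

(** If the profile contains the graph of u near y0, then the surface contains the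
    graph of x^2/2 + b x y + u(y) near (0, y0), so that any local graph f of the
    moved surface coincides there with this function up to the congruence. *)
Lemma profile_curvature (f : 'cV[R]_2 -> R) y0 u u1 u2 :
  C2_jet u u1 u2 y0 -> (\forall y \near y0, profile (y, u y)) ->
  let P := g (vec3 0 y0 (u y0)) in
  local_graph (g @` S0) P f ->
  \tr (hessian f (xy P)) = 1 + u2 y0 /\
  \det (hessian f (xy P)) = 1 * u2 y0 - b ^+ 2.
Proof.
move=> jet Cu P [[U [oU UP Cf]] gr].
have PE : xy P = xy o + y0 *: B2.
  by rewrite xy_congruence !vec3E scale0r addr0.
have cu : {for y0, continuous u}.
  have [du _ _] := nbhs_singleton jet.
  by apply/differentiable_continuous/derivable1_diffP.
pose G := fun z : R * R => g (vec3 z.1 z.2 (z.1 ^+ 2 / 2 + b * z.1 * z.2 + u z.2)).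
have i1 : fst @ ((0 : R), y0) --> (0 : R) by exact: cvg_fst.
have i2 : snd @ ((0 : R), y0) --> y0 by exact: cvg_snd.
have cG : G @ ((0 : R), y0) --> P.
  have cg := @continuous_isotropic R e c d c1 c2 1 o (vec3 0 y0 (u y0)).
  apply: (@cvg_comp _ _ _ _ g) cg.
  have -> : u y0 = (0 : R) ^+ 2 / 2 + b * 0 * y0 + u y0 by ring.
  have i3 := cvg_comp _ u i2 cu.
  exact: cvg_vec3 i1 i2 (cvgD (cvgD (cvgMr_tmp (cvgM i1 i1)) (cvgM (cvgMl_tmp i1) i2)) i3).
have near_graph : \forall z \near ((0 : R), y0), f (xy o + z.1 *: B1 + z.2 *: B2) =
   z.1 ^+ 2 / 2 + b * z.1 * z.2 + u z.2 + c1 * z.1 + c2 * z.2 + zc o.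
  have Cz : \forall z \near ((0 : R), y0), profile (z.2, u z.2) by exact: (i2 _ Cu).
  apply: filterS2 Cz (cG _ gr) => -[x y] /= Cy h.
  have : zc (G (x, y)) = f (xy (G (x, y))).
    apply: h; exists (vec3 x y (x ^+ 2 / 2 + b * x * y + u y)) => //.
    apply/profileP; rewrite /profile_point !vec3E.
    by have -> : x ^+ 2 / 2 + b * x * y + u y - x ^+ 2 / 2 - b * x * y = u y by ring.
  by rewrite xy_congruence zc_congruence /= !vec3E => <-.
have [d11 d12 d21 d22] := second_derivatives_translational jet near_graph.
have [-> ->] := hessian_orthonormal_frame oU UP Cf (sqr_signb R e) cd1.
by rewrite PE d11 d12 d21 d22.
Qed.
End Profile.

(** * From a constant ratio to a quadric *)

Lemma ratio_form_of_curvatures (R : realType) (a k1 k2 al be ga : R) :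
  k1 * k2 != 0 -> k1 / k2 = a \/ k2 / k1 = a ->
  al + ga = k1 + k2 -> al * ga - be ^+ 2 = k1 * k2 -> ratio_form a al be ga.
Proof.
move=> k0 ka tr dt; split; last by rewrite dt.
rewrite tr dt; move: k0; rewrite mulf_eq0 negb_or => /andP[k10 k20].
by case: ka => <-; field.
Qed.

(** The defining equation is quadratic in the last coefficient with leading
    coefficient a: adding its values at x and y and subtracting twice its value
    at the midpoint gives a (x - y)^2 / 2. *)
Lemma ratio_form_midpoint_free (R : realType) (a al be x y : R) :
  a != 0 -> ratio_form a al be x -> ratio_form a al be y -> x != y ->
  ~ ratio_form a al be ((x + y) / 2).
Proof.
move=> a0 [Ex _] [Ey _] xy [Em _].
have : a * (x - y) ^+ 2 = 0 by lra.
by move/eqP; rewrite mulf_eq0 (negPf a0) sqrf_eq0 subr_eq0 (negPf xy).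
Qed.

Lemma parabolic_rotational_constant_ratio_quadric (R : realType) (a : R) (S : set 'cV[R]_3) :
  a != 0 -> parabolic_rotational S -> constant_ratio a S ->
  exists al be ga l m n, ratio_form a al be ga /\
    forall p, S p -> on_quadric al be ga l m n p.
Proof.
move=> a0 [S0 [b [g [[conS0 _] invS0 gc ->]]]] cr.
suff [al [be [ga [l [m [n [rf quad]]]]]]] : exists al be ga l m n,
    ratio_form a al be ga /\ forall p, S0 p -> on_quadric al be ga l m n p.
  have [al' [be' [ga' [l' [m' [n' [rf' quad']]]]]]] := congruence_quadric l m n gc rf.
  exists al', be', ga', l', m', n'; split=> // _ [p Sp <-]; exact/quad'/quad.
have [e [phi [c1 [c2 [v gE]]]]] := gc.
have cd1 := cos2Dsin2 phi.
have {gE}gE : g = fun p => isotropic_mx e (cos phi) (sin phi) c1 c2 1 *m p + v by exact/funext.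
have graphC p : profile S0 p -> exists u u1 u2, C2_jet u u1 u2 p.1 /\
    \forall q \near p, profile S0 q -> q.2 = u q.1.
  move=> Cp.
  have [|k1 [k2 [[f [lg _]] _ _]]] := cr (g (vec3 0 p.1 p.2)).
    by exists (vec3 0 p.1 p.2).
  have lgr : exists f, local_graph (g @` S0) (g (vec3 0 p.1 p.2)) f by exists f.
  by rewrite gE in lgr; exact: profile_locally_graph Cp lgr.
have curvC y0 u u1 u2 : C2_jet u u1 u2 y0 -> (\forall y \near y0, profile S0 (y, u y)) ->
    ratio_form a 1 b (u2 y0).
  move=> jet Cu.
  have [|k1 [k2 [[f [lg cp]] k0 ka]]] := cr (g (vec3 0 y0 (u y0))).
    by exists (vec3 0 y0 (u y0)) => //; exact: nbhs_singleton Cu.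
  move/char_poly22_factor: cp => [tr dt]; subst g.
  have [tr' dt'] := profile_curvature invS0 cd1 jet Cu lg.
  by apply: (ratio_form_of_curvatures k0 ka); rewrite -?tr' -?dt'.
have Zmid x y := @ratio_form_midpoint_free R a 1 b x y a0.
have [[[y1 z1] one]|[w [m [n [rf Cq]]]]] :=
  connected_curve_on_parabola (connected_profile conS0 invS0) graphC curvC Zmid.
(* Over the single point (y1, z1) of the profile lies one parabola, to which the
   Hessian diag(1, a) is adjusted by the linear terms. *)
- exists 1, 0, a, (b * y1), 0, (z1 - a * y1 ^+ 2 / 2); split.
    by split; [ring|rewrite expr0n subr0 mul1r].
  by move=> p /(profileP invS0) /one [<- <-]; rewrite /on_quadric; field.
- exists 1, b, w, 0, m, n; split=> // p /(profileP invS0) /Cq.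
  by rewrite /on_quadric /quadratic /= => E; lra.
Qed.

Theorem proposition4 (R : realType) (a : R) (S : set 'cV[R]_3) :
  a != 0 -> surface S -> admissible S -> parabolic_rotational S ->
  (constant_ratio a S <->
   exists P : set 'cV[R]_3, P `<=` paraboloid a /\ isotropic_similar S P).
Proof.
move=> a0 _ _ prS; split=> [cr|[P [Pa SP]]]; last exact: paraboloid_constant_ratio Pa SP.
have [al [be [ga [l [m [n [rf quad]]]]]]] :=
  parabolic_rotational_constant_ratio_quadric a0 prS cr.
have [g gs gP] := quadric_isotropic_paraboloid l m n a0 rf.
exists (g @` S); split; last by exists g.
by move=> _ [p /quad Sp <-]; exact: gP.
Qed.
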